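(* Let $S$ be a right LCM monoid. Then $S$ admits at most one generalized scale; that is, if $M,N\colon S\to\mathbb{N}^\times$ are generalized scales on $S$, then $M=N$.
   Context: $\mathbb{N}^\times$ denotes the multiplicative monoid of positive integers. A right LCM monoid is a left cancellative monoid $S$ (with unit) in which the intersection $sS\cap tS$ of any two principal right ideals is either empty or again a principal right ideal. For $s,t\in S$ write $s\Cap t$ if $sS\cap tS\neq\emptyset$, and $s\perp t$ otherwise. The core of $S$ is $S_c:=\{a\in S\mid a\Cap s\text{ for all }s\in S\}$. Elements $s,t\in S$ are core equivalent, $s\sim t$, if there are $a,b\in S_c$ with $sa=tb$; this is an equivalence relation. A generalized scale on $S$ is a nontrivial homomorphism (not identically $1$) $N\colon S\to\mathbb{N}^\times$, $s\mapsto N_s$, such that: (1) $|N^{-1}(n)/_\sim|=n$ for all $n\in N(S)$; (2) $N_s=N_t$ implies $s\sim t$ or $s\perp t$; (3) for all $s\in S$ and $n\in N(S)$ there exists $t\in N^{-1}(n)$ with $s\Cap t$. *)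

(* Defs.v *)
From HB Require Import structures.
From mathcomp Require Import all_boot.
From mathcomp Require Import all_classical.

Set Implicit Arguments.
Unset Strict Implicit.
Unset Printing Implicit Defensive.

Local Open Scope classical_set_scope.
Local Open Scope card_scope.
Local Open Scope group_scope.

(* The multiplicative monoid N^x of positive integers. *)
Record posnat : Type := PosNat { posnat_val : nat; _ : (0 < posnat_val)%N }.

HB.instance Definition _ := [isSub for posnat_val].
HB.instance Definition _ := [Choice of posnat by <:].

Definition posnat_one : posnat := PosNat (ltn0Sn 0).

Lemma posnat_mul_subproof (m n : posnat) : (0 < val m * val n)%N.
Proof. by rewrite muln_gt0 (valP m) (valP n). Qed.

Definition posnat_mul (m n : posnat) : posnat :=
  PosNat (posnat_mul_subproof m n).

Lemma posnat_mulA : associative posnat_mul.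
Proof. by move=> x y z; apply: val_inj; rewrite /= mulnA. Qed.

Lemma posnat_mul1 : left_id posnat_one posnat_mul.
Proof. by move=> x; apply: val_inj; rewrite /= mul1n. Qed.

Lemma posnat_mulr1 : right_id posnat_one posnat_mul.
Proof. by move=> x; apply: val_inj; rewrite /= muln1. Qed.

HB.instance Definition _ :=
  isMonoid.Build posnat posnat_mulA posnat_mul1 posnat_mulr1.

Definition principal_right_ideal (S : monoidType) (s : S) : set S :=
  range (fun x : S => s * x).

(* [right_injective] from ssrfun says that every left translation
   [x |-> s * x] is injective, i.e. that S is left cancellative. *)
Definition right_LCM (S : monoidType) : Prop :=
  right_injective (@mul S) /\
  forall s t : S,
    principal_right_ideal s `&` principal_right_ideal t = set0 \/
    exists r : S, principal_right_ideal s `&` principal_right_ideal t =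
                  principal_right_ideal r.

Definition meets (S : monoidType) (s t : S) : Prop :=
  principal_right_ideal s `&` principal_right_ideal t !=set0.

Definition orthogonal (S : monoidType) (s t : S) : Prop := ~ meets s t.

Definition core_submonoid (S : monoidType) : set S :=
  [set a : S | forall s : S, meets a s].

Definition core_equiv (S : monoidType) (s t : S) : Prop :=
  exists a b : S, [/\ core_submonoid a, core_submonoid b & s * a = t * b].

(* The set A/R of the equivalence classes of the restriction of R to A. *)
Definition quotient_set (T : Type) (A : set T) (R : T -> T -> Prop) :
    set (set T) :=
  (fun x => A `&` [set y | R x y]) @` A.

Definition generalized_scale (S : monoidType) (N : S -> posnat) : Prop :=
  [/\ monoid_morphism N,
      exists s : S, N s <> 1,
      forall n : posnat, range N n ->
        quotient_set (N @^-1` [set n]) (@core_equiv S) #= `I_(posnat_val n),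
      forall s t : S, N s = N t -> core_equiv s t \/ orthogonal s t
    & forall (s : S) (n : posnat), range N n ->
        exists2 t : S, (N @^-1` [set n]) t & meets s t].

(* Main.v *)
(* For a generalized scale [N] one has [S_c = ker N], and a pigeonhole argument
   on transversals of [N^-1(n)/~] shows that elements whose right LCM has the
   largest possible scale meet exhaustively.  Now argue by induction on [N_s].
   If [N_s] factors in [N(S)], then [s] is core equivalent to a corresponding
   product.  If [N_s = n] is an atom of [N(S)], let [N_t = n] and choose, by
   axiom (3) for [M], some [v] meeting [s] with [M_v = M_t].  Writing the right
   LCM of [v] and [s] as [v p], either [N_p = 1], so that [v ~ s q] and
   [M_s | M_t]; or [N_p = n], so that [v] meets all of [N^-1(n)], whence
   [v ~ t], [N_v = n], [v ~ s] and again [M_s | M_t].  By symmetry [M] is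
   constant on [N^-1(n)], with value [m] say; then [N^-1(n) = M^-1(m)], and
   counting core classes gives [n = m]. *)
Require Import Defs.
From mathcomp Require Import all_boot.
From mathcomp Require Import all_classical.
(* [classical_sets] also defines a [meets]. *)
Import Defs.

Set Implicit Arguments.
Unset Strict Implicit.
Unset Printing Implicit Defensive.

Local Open Scope classical_set_scope.
Local Open Scope group_scope.

Lemma posnat_mulC (m n : posnat) : m * n = n * m.
Proof. by apply: val_inj; rewrite /= mulnC. Qed.

Lemma posnat_mulI (k m n : posnat) : k * m = k * n -> m = n.
Proof.
move=> /(congr1 val) /= /eqP; rewrite eqn_pmul2l ?(valP k) // => /eqP.
exact: val_inj.
Qed.

Lemma posnat_mul_eq1 (m n : posnat) : m * n = 1 -> m = 1 /\ n = 1.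
Proof.
move=> /(congr1 val) /= /eqP; rewrite muln_eq1 => /andP[/eqP m1 /eqP n1].
by split; apply: val_inj.
Qed.

Lemma posnat_dvd_antisym (m n k l : posnat) : m = n * k -> n = m * l -> m = n.
Proof.
move=> mE nE; have : m * (l * k) = m * 1 by rewrite mulgA -nE -mE mulg1.
by move=> /posnat_mulI /posnat_mul_eq1[l1 _]; rewrite nE l1 mulg1.
Qed.

Lemma posnat_neq1_ltn (m n : posnat) :
  n <> 1 -> (posnat_val m < posnat_val (m * n)%g)%N.
Proof.
move=> n1; rewrite -{1}(muln1 (posnat_val m)) ltn_pmul2l; last exact: (valP m).
rewrite ltn_neqAle (valP n) andbT; apply/eqP => n1'.
by apply: n1; apply: val_inj.
Qed.

Section RightLCM.
Context {S : monoidType}.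
Implicit Types s t u v p q : S.

Lemma meetsP s t : meets s t <-> exists x y, s * x = t * y.
Proof.
split=> [[_ [[x _ <-] [y _ xy]]]|[x [y xy]]]; first by exists x, y.
by exists (s * x); split; [exists x | exists y].
Qed.

Lemma meetsC s t : meets s t -> meets t s.
Proof. by move=> /meetsP[x [y xy]]; apply/meetsP; exists y, x. Qed.

Lemma meets_mull s x t : meets (s * x) t -> meets s t.
Proof.
by move=> /meetsP[y [z]]; rewrite -mulgA => e; apply/meetsP; exists (x * y), z.
Qed.

Lemma core_equivC s t : core_equiv s t -> core_equiv t s.
Proof. by move=> [a [b [ca cb e]]]; exists b, a. Qed.

(** If [s * a = t * b] and [s * x = u * y], the core element [a] meets [x], so [a * e = x * f] and
    [t * b * e = u * y * f]. *)
Lemma core_equiv_meets s t u : core_equiv s t -> meets s u -> meets t u.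
Proof.
move=> [a [b [ca _ sa]]] /meetsP[x [y sx]].
have /meetsP[e [f ae]] := ca x.
apply/meetsP; exists (b * e), (y * f).
by rewrite !mulgA -sa -sx -!mulgA ae.
Qed.

Lemma right_lcm_exists s t : right_LCM S -> meets s t ->
  exists p q, s * p = t * q /\
    forall x y, s * x = t * y -> exists z, x = p * z.
Proof.
move=> [canc lcm] [r str]; case: (lcm s t) => [st0|[r' st]].
  by rewrite st0 in str.
have : (principal_right_ideal s `&` principal_right_ideal t) r'.
  by rewrite st; exists 1 => //; rewrite mulg1.
move=> [[p _ sp] [q _ tq]]; exists p, q; split; first by rewrite sp tq.
move=> x y xy.
have : (principal_right_ideal s `&` principal_right_ideal t) (s * x).
  by split; [exists x | exists y].
rewrite st => -[z _ rz]; exists z.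
by apply: (canc s); rewrite -rz -sp /= -mulgA.
Qed.

Section Scale.
Context {N : S -> posnat} (hN : generalized_scale N).

Lemma scale1 : N 1 = 1.
Proof. by case: hN => -[]. Qed.

Lemma scaleM s t : N (s * t) = N s * N t.
Proof. by case: hN => -[]. Qed.

Lemma scale_meets s n : exists2 t, N t = N n & meets s t.
Proof. by case: hN => _ _ _ _ /(_ s (N n)); apply; exists n. Qed.

Lemma scale_meets_core_equiv s t : N s = N t -> meets s t -> core_equiv s t.
Proof. by case: hN => _ _ _ h _ /h[|o m] //; case: (o m). Qed.

Lemma scale_meets_trans s t u :
  N s = N t -> meets s t -> meets s u -> meets t u.
Proof. by move=> st m; apply: core_equiv_meets; apply: scale_meets_core_equiv. Qed.

Lemma meets_refl s : meets s s.
Proof. by apply/meetsP; exists 1, 1. Qed.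

(** Usable form of axiom (1): [e] picks one representative per class. Within a fibre, axiom (2)
    makes core equivalence the same as meeting. *)
Lemma scale_transversal s :
  exists e : 'I_(posnat_val (N s)) -> S,
    [/\ forall i, N (e i) = N s,
        forall i j, meets (e i) (e j) -> i = j
      & forall t, N t = N s -> exists i, meets t (e i)].
Proof.
case: (hN) => _ _ + _ _ => /(_ (N s)) card.
have {card} := card (ex_intro2 _ _ s I erefl).
rewrite card_eq_sym => /card_set_bijP[h [hfun hinj hsurj]].
have /choice[e he] : forall i : 'I_(posnat_val (N s)), exists x,
    N x = N s /\ h i = (N @^-1` [set N s]) `&` [set y | core_equiv x y].
  by move=> i; have [x Nx <-] := hfun i (ltn_ord i); exists x.
exists e; split=> [i|i j eij|t Nt]; first by case: (he i).
- apply: val_inj; apply: hinj; rewrite ?inE /=; try exact: ltn_ord.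
  have [[Ni ->] [Nj ->]] := (he i, he j).
  apply/seteqP; split=> y [Ny] /core_equiv_meets ey; split=> //;
    apply: scale_meets_core_equiv; rewrite ?Ni ?Nj //.
  + apply: (@scale_meets_trans (e i)); rewrite ?Ni ?Nj //.
    by apply: meetsC; apply: ey; apply: meets_refl.
  + apply: (@scale_meets_trans (e j)); rewrite ?Ni ?Nj //.
      exact: meetsC.
    by apply: meetsC; apply: ey; apply: meets_refl.
- have [|i ilt hi] := hsurj ((N @^-1` [set N s]) `&` [set y | core_equiv t y]).
    by exists t.
  exists (Ordinal ilt); have [Ni hi'] := he (Ordinal ilt).
  have : h i (e (Ordinal ilt)).
    rewrite [h i]hi'; split=> //.
    by apply: scale_meets_core_equiv => //; apply: meets_refl.
  rewrite hi => -[_ /core_equiv_meets te].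
  by apply: meetsC; apply: te; apply: meets_refl.
Qed.

(** A core element meets its whole fibre, which is thus a single class. Conversely, [a] meets [1],
    so scale 1 gives [a * c = d] with [d] in the core. *)
Lemma core_scale a : core_submonoid a <-> N a = 1.
Proof.
split=> [ca|Na1 s].
- have [e [Ne einj ecov]] := scale_transversal a.
  have le1 : (posnat_val (N a) <= 1)%N.
    rewrite -[posnat_val _]card_ord -[1%N]card_unit.
    apply: (@leq_card _ _ (fun=> tt)) => i j _; apply: einj.
    by apply: (@scale_meets_trans a); rewrite ?Ne.
  by apply: val_inj; apply/eqP; rewrite eqn_leq le1 (valP (N a)).
- have [||c [d [_ cd]]] := @scale_meets_core_equiv a 1.
  + by rewrite scale1.
  + by apply/meetsP; exists 1, a; rewrite mul1g mulg1.
  rewrite mul1g => ac; apply: (@meets_mull a c); rewrite ac; exact: cd.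
Qed.

Lemma scale_core_equiv s t : core_equiv s t -> N s = N t.
Proof.
move=> [a [b [/core_scale Na /core_scale Nb /(congr1 N)]]].
by rewrite !scaleM Na Nb !mulg1.
Qed.

Lemma scale_split s v k : meets s v -> N v = N s * N k ->
  exists2 q, N q = N k & core_equiv v (s * q).
Proof.
move=> /meetsP[x [y xy]] Nv; have [q Nq /meetsP[e [f xe]]] := scale_meets x k.
exists q => //; apply: scale_meets_core_equiv; first by rewrite scaleM Nq.
by apply/meetsP; exists (y * e), f; rewrite mulgA -xy -!mulgA xe.
Qed.

(** Take [x] of scale [N t] meeting [p]. Then [s * x] meets [t], hence is core equivalent to some
    [t * y]; so [x], up to a core factor, is a right multiple of [p]. *)
Lemma scale_lcm_dvd s t p q : s * p = t * q ->
  (forall x y, s * x = t * y -> exists z, x = p * z) ->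
  exists z, N t = N p * N z.
Proof.
move=> pq lcm; have [x Nx /meetsP[e [f pe]]] := scale_meets p t.
have txm : meets t (s * x).
  by apply/meetsP; exists (q * e), f; rewrite mulgA -pq -!mulgA pe.
have [|y _ [a [b [/core_scale Na _ eab]]]] := @scale_split t (s * x) s txm.
  by rewrite scaleM Nx posnat_mulC.
have [|z xa] := lcm (x * a) (y * b); first by rewrite !mulgA.
by exists z; rewrite -scaleM -xa scaleM Na mulg1 Nx.
Qed.

Lemma scale_atom_split_or_meets (hS : right_LCM S) s v :
    (forall x y, N s = N x * N y -> N x = 1 \/ N y = 1) -> meets v s ->
  (exists q, core_equiv v (s * q)) \/ forall t, N t = N s -> meets v t.
Proof.
move=> atom vs.
have [[t [q [Nt vt]]]|nsplit] :=
  pselect (exists t q, N t = N s /\ core_equiv v (t * q)).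
  left; have [||x _ vx] := @scale_split s v q.
  - exact: meetsC.
  - by rewrite (scale_core_equiv vt) scaleM Nt.
  - by exists x.
right.
(* The scale of the cofactor [p] divides the atom [N s]; scale 1 would give [v] core equivalent to
   [t * q], which is excluded here. *)
have lcm_top t : N t = N s -> meets v t -> exists2 p, N p = N s &
    forall x y, v * x = t * y -> exists z, x = p * z.
  move=> Nt /(right_lcm_exists hS)[p [q [pq lcm]]]; exists p => //.
  have [z] := scale_lcm_dvd pq lcm; rewrite Nt => Nsz.
  have [Np|Nz] := atom _ _ Nsz; last by rewrite Nsz Nz mulg1.
  case: nsplit; exists t, q; split=> //; exists p, 1.
  by split; rewrite ?mulg1 //; apply/core_scale; rewrite ?scale1.
have [e [Ne einj ecov]] := scale_transversal s.
have /choice[f fP] : forall i, exists j, meets (v * e i) (e j).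
  move=> i; have [t Nt vt] := scale_meets (v * e i) s.
  have [j tj] := ecov _ Nt; exists j; apply: meetsC.
  by apply: (@scale_meets_trans t) => //; [rewrite Ne | apply: meetsC].
have finj : injective f.
  (* With [p] the cofactor of [v] in its right LCM with [e (f i)], both [e i] and [e j] meet [p],
     and all three have scale [N s]. *)
  move=> i j fij.
  have [p Np lcm] := lcm_top _ (Ne (f i)) (meets_mull (fP i)).
  have pe k : f k = f i -> meets p (e k).
    move=> fk; have /meetsP[x [y]] := fP k; rewrite fk -mulgA => /lcm[z ez].
    by apply/meetsP; exists z, x.
  apply: einj; apply: (@scale_meets_trans p); rewrite ?Np ?Ne //; exact: pe.
move=> t Nt; have [j tj] := ecov _ Nt.
have /codomP[i ji] := injF_onto finj j.
apply: meetsC; apply: (@scale_meets_trans (e j)); first by rewrite Ne.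
  exact: meetsC.
by apply: meetsC; rewrite ji; apply: meets_mull (fP i).
Qed.

End Scale.

(** Meeting does not depend on the scale, so sending each representative for one scale to one it
    meets for the other is injective. *)
Lemma scale_eq_of_fiber_eq (M N : S -> posnat) s :
    generalized_scale M -> generalized_scale N ->
  (forall t, M t = M s <-> N t = N s) -> M s = N s.
Proof.
have le (M' N' : S -> posnat) : generalized_scale M' -> generalized_scale N' ->
    (forall t, M' t = M' s <-> N' t = N' s) ->
    (posnat_val (M' s) <= posnat_val (N' s))%N.
  move=> hM hN MN.
  have [e [Me einj _]] := scale_transversal hM s.
  have [d [Nd _ dcov]] := scale_transversal hN s.
  have /choice[f fP] : forall i, exists j, meets (e i) (d j).
    by move=> i; apply: dcov; apply/MN.
  rewrite -[posnat_val (M' s)]card_ord -[posnat_val (N' s)]card_ord.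
  apply: (@leq_card _ _ f) => i j fij; apply: einj.
  apply: (@scale_meets_trans _ hN (d (f i))).
  - by rewrite Nd; apply/esym/MN.
  - by apply: meetsC; apply: fP.
  - by rewrite fij; apply: meetsC; apply: fP.
move=> hM hN MN; apply: val_inj; apply/eqP; rewrite eqn_leq.
by rewrite !le // => t; split=> /MN.
Qed.

Lemma scale_atom_dvd (M N : S -> posnat) s t : right_LCM S ->
    generalized_scale M -> generalized_scale N ->
    (forall x y, N s = N x * N y -> N x = 1 \/ N y = 1) -> N t = N s ->
  exists k, M t = M s * k.
Proof.
move=> hS hM hN atom Nt.
have [v Mv /meetsC vs] := scale_meets hM s t.
have [[q vq]|vall] := scale_atom_split_or_meets hN hS atom vs.
  by exists (M q); rewrite -Mv -(scaleM hM); apply: scale_core_equiv.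
(* Core equivalence obtained from [M] is also respected by [N], so [N v = N t = N s]. *)
have vt := scale_meets_core_equiv hM Mv (vall t Nt).
exists 1; rewrite mulg1 -Mv; apply: (scale_core_equiv hM).
apply: (scale_meets_core_equiv hN) => //.
by rewrite (scale_core_equiv hN vt).
Qed.

End RightLCM.

Theorem theorem3p6 (S : monoidType) (hS : right_LCM S) (M N : S -> posnat)
  (hM : generalized_scale M) (hN : generalized_scale N) : M = N.
Proof.
apply/funext => s; have [n] := ubnP (posnat_val (N s)).
elim: n s => // n IH s; rewrite ltnS => Ns.
have [[x [y [Nxy Nx Ny]]]|natom] :=
  pselect (exists x y, [/\ N s = N x * N y, N x <> 1 & N y <> 1]).
  (* [x] itself need not meet [s]; axiom (3) replaces it by [x'] of the same scale. *)
  have [x' Nx' /meetsC xs] := scale_meets hN s x.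
  have [|q Nq sxq] := @scale_split _ _ hN x' s y xs; first by rewrite Nx'.
  rewrite (scale_core_equiv hM sxq) (scale_core_equiv hN sxq).
  rewrite (scaleM hM) (scaleM hN) !IH //.
  - apply: leq_trans Ns; rewrite Nq Nxy posnat_mulC.
    exact: posnat_neq1_ltn.
  - apply: leq_trans Ns; rewrite Nx' Nxy.
    exact: posnat_neq1_ltn.
have atom x y : N s = N x * N y -> N x = 1 \/ N y = 1.
  move=> Nxy; have [|Nx] := pselect (N x = 1); first by left.
  have [|Ny] := pselect (N y = 1); first by right.
  by case: natom; exists x, y.
have Mconst t : N t = N s -> M t = M s.
  move=> Nt; have [k Mt] := scale_atom_dvd hS hM hN atom Nt.
  have [||l Ms] := @scale_atom_dvd S M N t s hS hM hN; rewrite ?Nt //.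
  exact: posnat_dvd_antisym Mt Ms.
apply: scale_eq_of_fiber_eq => // t; split=> [Mt|]; last exact: Mconst.
(* [u] lies in the [N]-fibre of [s], so [M u = M s = M t]; as it meets [t], it is core equivalent to
   [t]. *)
have [u Nu tu] := scale_meets hN t s.
rewrite -Nu; apply: (scale_core_equiv hN).
by apply: (scale_meets_core_equiv hM) => //; rewrite Mt Mconst.
Qed.
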